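(* Let $G=Z_{2^{\lambda_1}}\times\cdots\times Z_{2^{\lambda_n}}$ with $\lambda_1\le\cdots\le\lambda_n$, and let $\mathbf m$ be a canonical tuple of $G$. Then the characteristic subgroups of $G$ below $\mathbf m$ are in one-to-one correspondence with the projection-surjective subgroups of $Z_2^r$, where $r$ is the number of nondegenerate coordinates of $\mathbf m$.
   Context: Set $\lambda_0=0$ and, for any tuple, $a_0=0$. Tuples are ordered componentwise; $\Lambda(G)=\{\mathbf a\in\mathbb Z^n:\mathbf 0\le\mathbf a\le(\lambda_1,\dots,\lambda_n)\}$. For $\mathbf a\in\Lambda(G)$, $T(\mathbf a)$ is the set of $(g_1,\dots,g_n)\in G$ with $|g_i|=2^{a_i}$ for all $i$. A tuple $\mathbf a\in\Lambda(G)$ is canonical if (I) $a_i\ge a_{i-1}$ for $i\in\{2,\dots,n\}$ and (II) $a_{i+1}-a_i\le\lambda_{i+1}-\lambda_i$ for $i\in\{1,\dots,n-1\}$. A canonical tuple $\mathbf a$ is degenerate at coordinate $i\in\{1,\dots,n\}$ if $a_i=a_{i-1}$, or ($i\le n-1$ and) $a_{i+1}-a_i=\lambda_{i+1}-\lambda_i$; otherwise $i$ is a nondegenerate coordinate. For a characteristic subgroup $H$ of $G$, define $\mathbf m$ by $m_i=\max\{a_i:\mathbf a\in\Lambda(G),\ T(\mathbf a)\subseteq H\}$; $H$ is then called a characteristic subgroup below $\mathbf m$. A subgroup $K$ of a direct product $K_1\times\cdots\times K_l$ is projection-surjective if its projection onto each factor $K_i$ is all of $K_i$. *)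

(* Defs.v *)
From mathcomp Require Import all_boot all_fingroup all_algebra all_solvable.
Set Implicit Arguments. Unset Strict Implicit. Unset Printing Implicit Defensive.

(* Conventions: coordinates are numbered 1..n; [lam : nat -> nat] gives
   lambda_1..lambda_n (value at 0 and beyond n irrelevant); lambda_0 = 0 and
   a_0 = 0 are enforced via [ext0]. *)
Definition ext0 (f : nat -> nat) (i : nat) : nat := if i == 0 then 0 else f i.

(* Ambient finite abelian group: row vectors of length n over Z/2^(M+1) (group law = addition), M = max lambda_i.
   Coordinate j : 'I_n corresponds to paper coordinate j+1. *)
Definition lmax (n : nat) (lam : nat -> nat) : nat := \max_(j < n) lam j.+1.
Notation amb n lam := 'rV['Z_(2 ^ (lmax n lam).+1)]_n.

(* G = Z_{2^lam_1} x ... x Z_{2^lam_n}, realized as the subgroup of elements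
   whose j-th component lies in the unique cyclic subgroup of order 2^lam_(j+1). *)
Definition Gset (n : nat) (lam : nat -> nat) : {set amb n lam} :=
  [set g : amb n lam | [forall j : 'I_n, #[g ord0 j]%g %| 2 ^ lam j.+1]].

Lemma Gset_group n lam : group_set (Gset n lam).
Proof.
apply/group_setP; split.
  by rewrite inE; apply/forallP => j; rewrite mxE order1 dvd1n.
move=> x y; rewrite !inE => /forallP hx /forallP hy; apply/forallP => j.
rewrite mxE; have := hx j; have := hy j.
move: (x ord0 j) (y ord0 j) => a b ha hb.
rewrite order_dvdn in ha; rewrite order_dvdn in hb; rewrite order_dvdn.
by rewrite expgMn ?(eqP ha) ?(eqP hb) ?mulg1 //; exact: GRing.addrC.
Qed.
Canonical Ggroup n lam : {group amb n lam} := Group (Gset_group n lam).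

Definition tupT n lam := {ffun 'I_n -> 'I_(lmax n lam).+1}.
Definition inLambda n lam (a : tupT n lam) : bool :=
  [forall j : 'I_n, (a j : nat) <= lam j.+1].

Definition Tset n lam (a : tupT n lam) : {set amb n lam} :=
  [set g in Gset n lam | [forall j : 'I_n, #[g ord0 j]%g == 2 ^ (a j : nat)]].

Definition mvec n lam (H : {set amb n lam}) (j : 'I_n) : nat :=
  \max_(a : tupT n lam | inLambda a && (Tset a \subset H)) (a j : nat).

Definition char_below n lam (m : nat -> nat) (H : {group amb n lam}) : Prop :=
  (H \char Ggroup n lam)%g /\ forall j : 'I_n, mvec H j = m j.+1.

Definition in_Lambda n (lam m : nat -> nat) : Prop :=
  forall i, 1 <= i <= n -> m i <= lam i.
Definition canonical n (lam m : nat -> nat) : Prop :=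
  [/\ in_Lambda n lam m,
      (forall i, 2 <= i <= n -> m i.-1 <= m i) &
      (forall i, 1 <= i < n -> m i.+1 + lam i <= lam i.+1 + m i)].
(* (II) a_{i+1} - a_i <= lam_{i+1} - lam_i, written additively (integers). *)

Definition degenerate n (lam m : nat -> nat) (i : nat) : bool :=
  (ext0 m i == ext0 m i.-1) || ((i < n) && (m i.+1 + lam i == lam i.+1 + m i)).

Definition nondeg_count n (lam m : nat -> nat) : nat :=
  count (fun i => ~~ degenerate n lam m i) (iota 1 n).

Definition proj_surj r (K : {group 'rV['Z_2]_r}) : Prop :=
  forall j : 'I_r, [set (k : 'rV['Z_2]_r) ord0 j | k in K] = [set: 'Z_2].

(* Main.v *)
Require Import Defs.
From mathcomp Require Import all_boot all_fingroup all_algebra all_solvable.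
Set Implicit Arguments. Unset Strict Implicit. Unset Printing Implicit Defensive.
From mathcomp Require Import zify.
From Stdlib Require Import ProofIrrelevance.
Import GRing.Theory.

(** For a canonical tuple [a] the box [B a] of elements whose i-th coordinate
    has order dividing [2 ^ a_i] is characteristic.  A characteristic subgroup
    [H] below [m] lies in [B m], and applying to it the automorphisms
    [g |-> g + c g_k e_i] shows that it contains the smaller box in which the
    bound at every nondegenerate coordinate is lowered by one.  The quotient of
    [B m] by that smaller box is [Z_2^r], so [H] is the preimage of its image
    there, which is projection-surjective as [m_i] is attained for each [i].
    Conversely, lowering [m] by one at a single nondegenerate coordinate leaves
    it canonical; hence automorphisms of [G] act trivially on [Z_2^r], and all
    preimages of subgroups of [Z_2^r] are characteristic. *)

(** * Orders of elements in a cyclic 2-group *)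

Lemma order_Zp_dvd L (x : 'Z_(2 ^ L.+1)) a :
  (#[x]%g %| 2 ^ a) = (x *+ 2 ^ a == 0)%R.
Proof. by rewrite order_dvdn FinRing.zmodXgE. Qed.

Lemma exp2S_gt1 L : 1 < 2 ^ L.+1.
Proof. by rewrite -{1}(expn0 2) ltn_exp2l. Qed.

Lemma natr_Zp_eq0 L k : (k%:R == 0 :> 'Z_(2 ^ L.+1))%R = (2 ^ L.+1 %| k).
Proof. by rewrite -(inj_eq val_inj) /= val_Zp_nat ?exp2S_gt1 //. Qed.

(** The representative of [x] is a multiple of [2 ^ (L.+1 - a)], and [b] does not exceed this
    exponent. *)
Lemma order_Zp_div L (x : 'Z_(2 ^ L.+1)) a b :
  #[x]%g %| 2 ^ a -> a + b <= L.+1 ->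
  exists2 y : 'Z_(2 ^ L.+1), x = (y *+ 2 ^ b)%R & #[y]%g %| 2 ^ (a + b).
Proof.
move=> hx hab; have hx' := hx; move: hx'.
rewrite order_Zp_dvd -[x]natr_Zp -mulrnA natr_Zp_eq0.
have {1}-> : L.+1 = (L.+1 - a) + a by rewrite subnK // (leq_trans (leq_addr b a)).
rewrite expnD dvdn_pmul2r ?expn_gt0 //.
move=> hd.
have : 2 ^ b %| x.
  by apply: dvdn_trans hd; apply: dvdn_exp2l; rewrite leq_subRL // (leq_trans _ hab) ?leq_addr.
case/dvdnP=> k hk; have e : x = (k%:R *+ 2 ^ b)%R.
  by rewrite -[LHS]natr_Zp hk natrM mulr_natr.
exists (k%:R)%R; first by rewrite natr_Zp.
by rewrite order_Zp_dvd addnC expnD mulrnA -e -order_Zp_dvd.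
Qed.

Lemma order_Zp_pow2 L (x : 'Z_(2 ^ L.+1)) : #[x]%g = 2 ^ logn 2 #[x]%g.
Proof.
have: #[x]%g %| 2 ^ L.+1.
  by rewrite order_Zp_dvd -[x]natr_Zp -mulrnA natr_Zp_eq0 dvdn_mull.
by case/(dvdn_pfactor _ _ (isT : prime 2)) => k _ ->; rewrite pfactorK.
Qed.

Lemma Zp_cyclic L : cyclic [set: 'Z_(2 ^ L.+1)].
Proof. by apply/cyclicP; exists Zp1; exact: Zp_cycle. Qed.

Lemma order_Zp_mul L (x y : 'Z_(2 ^ L.+1)) :
  #[y]%g %| #[x]%g -> exists k, y = (x *+ k)%R.
Proof.
move=> h; have : y \in <[x]>%g.
  by rewrite -cycle_subG -(cardSg_cyclic (Zp_cyclic L)) ?subsetT.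
by case/cycleP=> k ->; exists k; rewrite FinRing.zmodXgE.
Qed.

(** Elements of equal order generate the same subgroup, so [y = k x], and [k] is odd once the order
    is even. For [x = 0] the factor [k] could be even, hence the separate choice [u = 1]. *)
Lemma order_Zp_unit L (x y : 'Z_(2 ^ L.+1)) : #[y]%g = #[x]%g ->
  exists2 u : 'Z_(2 ^ L.+1), u \is a GRing.unit & y = (u * x)%R.
Proof.
move=> h; have [x1|x1] := eqVneq #[x]%g 1%N.
  exists 1%R; rewrite ?unitr1 //.
  move/eqP: (x1); move/eqP: x1; rewrite -{1}h !order_eq1 => /eqP -> /eqP ->.
  by rewrite mul1r.
have [k hk] : exists k, y = (x *+ k)%R by apply: order_Zp_mul; rewrite h.
exists (k%:R)%R; last by rewrite hk mulr_natl.
rewrite unitZpE ?exp2S_gt1 // coprime_pexpl //.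
have : generator <[x]>%g (x ^+ k)%g.
  rewrite FinRing.zmodXgE -hk /generator (eq_subG_cyclic (Zp_cyclic L)) ?subsetT //.
  by rewrite -!orderE h.
rewrite generator_coprime order_Zp_pow2 coprime_pexpl //.
by case: logn x1 (order_Zp_pow2 x) => // x1 e; rewrite e in x1.
Qed.

Lemma exists_order_Zp L a : a <= L.+1 ->
  exists x : 'Z_(2 ^ L.+1), #[x]%g = 2 ^ a.
Proof.
move=> ha; exists ((Zp1 : 'Z_(2 ^ L.+1)) *+ 2 ^ (L.+1 - a))%R.
have o1 : #[Zp1 : 'Z_(2 ^ L.+1)]%g = 2 ^ L.+1.
  by rewrite order_Zp1 Zp_cast ?exp2S_gt1.
rewrite -FinRing.zmodXgE orderXdiv o1; last by rewrite dvdn_exp2l ?leq_subr.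
by rewrite -expnB ?leq_subr // subKn.
Qed.

Lemma Zp_order2 L (x : 'Z_(2 ^ L.+1)) :
  (x *+ 2 = 0 -> x != 0 -> x = (2 ^ L)%:R)%R.
Proof.
move=> x2 x0; have [|//|y ey _] := @order_Zp_div L x 1 L.
  by rewrite order_Zp_dvd x2.
have e : x = ((2 ^ L)%:R *+ odd y)%R.
  have /eqP h : ((y./2 * 2 ^ L.+1)%:R == 0 :> 'Z_(2 ^ L.+1))%R.
    by rewrite natr_Zp_eq0 dvdn_mull.
  rewrite ey -[y in LHS]natr_Zp -mulrnA -[in LHS](odd_double_half y) -muln2.
  by rewrite mulnDl -mulnA -expnS mulrnDr h addr0 mulnC mulrnA.
by rewrite e; case: odd e x0 => // ->; rewrite mulr0n eqxx.
Qed.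

(** Multiplication by [2 ^ a.-1] sends [x] and [y] to 0 or to the unique involution, and two
    involutions cancel. This makes the bits of [bit_row] additive. For [a = 0] both elements
    vanish. *)
Lemma order_Zp_dvdD L (x y : 'Z_(2 ^ L.+1)) a :
  #[x]%g %| 2 ^ a -> #[y]%g %| 2 ^ a ->
  (#[(x + y)%R]%g %| 2 ^ a.-1) = ((#[x]%g %| 2 ^ a.-1) == (#[y]%g %| 2 ^ a.-1)).
Proof.
case: a => [|b] /=.
  rewrite !order_Zp_dvd mulrnDl => hx hy.
  by rewrite (eqP hx) (eqP hy) addr0 eqxx.
rewrite !order_Zp_dvd mulrnDl (expnSr _ b) !mulrnA.
move: (x *+ _)%R (y *+ _)%R => X Y /eqP hX /eqP hY.
have [->|nX] := eqVneq X 0%R; first by rewrite add0r; case: eqP.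
have [->|nY] := eqVneq Y 0%R; first by rewrite addr0 (negPf nX).
by rewrite (Zp_order2 hX nX) (Zp_order2 hY nY) -mulr2n -(Zp_order2 hX nX) hX !eqxx.
Qed.

(** * Boxes as characteristic subgroups *)

(** An injective endomorphism of a finite group is onto. Explicit coordinate maps can thus be
    applied to [H] without building elements of [Aut G]. *)
Lemma char_endo_closed (gT : finGroupType) (G H : {group gT}) (F : gT -> gT) :
  (H \char G)%g -> {in G &, {morph F : x y / (x * y)%g}} ->
  {in G &, injective F} -> {in G, forall x, F x \in G} ->
  {in H, forall x, F x \in H}.
Proof.
case/charP=> sHG chH mF iF cF x Hx; pose f := Morphism mF.
have injf : ('injm f)%g by apply/injmP.
have Gf : (f @* G)%g = G.
  apply/eqP; rewrite eqEcard card_injm // leqnn andbT.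
  by apply/subsetP=> _ /morphimP[y _ Gy ->]; apply: cF.
by rewrite -(chH f injf Gf); apply: (mem_morphim f) => //; apply: (subsetP sHG).
Qed.

(** [Gset n lam] is the case [a := lam] by conversion, so [order_boxP] also decides membership in
    [Ggroup n lam]. *)
Definition order_box n lam (a : nat -> nat) : {set amb n lam} :=
  [set g : amb n lam | [forall j : 'I_n, #[g ord0 j]%g %| 2 ^ a j.+1]].
Arguments order_box {n} lam a.

Lemma order_boxP n lam a (g : amb n lam) :
  reflect (forall j, #[g ord0 j]%g %| 2 ^ a j.+1) (g \in order_box lam a).
Proof. by rewrite inE; apply: forallP. Qed.

Lemma order_box_group_set n lam a : group_set (@order_box n lam a).
Proof.
apply/group_setP; split; first by apply/order_boxP => j; rewrite mxE order1.
move=> x y /order_boxP hx /order_boxP hy; apply/order_boxP => j; rewrite mxE.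
move: (hx j) (hy j); rewrite !order_Zp_dvd mulrnDl => /eqP -> /eqP ->.
by rewrite addr0.
Qed.
Canonical order_box_group n lam a := Group (@order_box_group_set n lam a).

Lemma lam_le_lmax n lam (j : 'I_n) : lam j.+1 <= lmax n lam.
Proof. exact: (leq_bigmax j). Qed.

Lemma order_box_char n lam a :
  (forall i : 'I_n, a i.+1 <= lam i.+1) ->
  (forall i k : 'I_n, i <= k -> a i.+1 <= a k.+1) ->
  (forall i k : 'I_n, i <= k -> a k.+1 + lam i.+1 <= lam k.+1 + a i.+1) ->
  (order_box_group n lam a \char Ggroup n lam)%g.
Proof.
move=> hal hmon hlip.
have sub : order_box lam a \subset Ggroup n lam.
  apply/subsetP=> x /order_boxP hx; apply/order_boxP => j.
  exact: dvdn_trans (hx j) (dvdn_exp2l _ (hal j)).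
rewrite /characteristic sub /=; apply/forall_inP=> f fA.
apply/subsetP=> _ /imsetP[x xa ->]; apply/order_boxP=> i.
have /order_boxP hx := xa.
(* [2 ^ a_i] times [x] is [2 ^ lam_i] times an element of [G], so its image
   under [f] vanishes at coordinate [i]. *)
have /fin_all_exists [y hy] : forall k : 'I_n, exists y : 'Z_(2 ^ (lmax n lam).+1),
   (x ord0 k *+ 2 ^ a i.+1 = y *+ 2 ^ lam i.+1)%R /\ #[y]%g %| 2 ^ lam k.+1.
  (* For [k <= i], monotonicity makes [2 ^ a_i] kill [x_k]. For [k > i], the bound on [a_k - a_i]
     leaves room to divide [x_k] by [2 ^ (lam_i - a_i)] inside the subgroup of order [2 ^ lam_k]. *)
  move=> k; have [ki|ik] := leqP k i.
    exists 0%R; rewrite mul0rn order1 dvd1n; split=> //; apply/eqP.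
    by rewrite -order_Zp_dvd (dvdn_trans (hx k)) // dvdn_exp2l // hmon.
  have h1 : a k.+1 + (lam i.+1 - a i.+1) <= lam k.+1.
    by rewrite addnBA // leq_subLR addnC [a i.+1 + _]addnC (leq_trans _ (hlip i k (ltnW ik))) // addnC.
  have [|y -> hy] := order_Zp_div (b := lam i.+1 - a i.+1) (hx k).
    exact: leq_trans h1 (leqW (lam_le_lmax lam k)).
  exists y; rewrite -mulrnA -expnD subnK //; split=> //.
  by apply: dvdn_trans hy _; apply: dvdn_exp2l.
pose z : amb n lam := (\row_k y k)%R.
have zG : z \in Ggroup n lam.
  by apply/order_boxP => k; rewrite mxE; case: (hy k).
have xG : x \in Ggroup n lam by apply: (subsetP sub).
have e : (x ^+ (2 ^ a i.+1) = z ^+ (2 ^ lam i.+1))%g.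
  rewrite !FinRing.zmodXgE; apply/rowP=> k.
  by rewrite !mulmxnE mxE; case: (hy k).
have : (f x ^+ (2 ^ a i.+1) = f z ^+ (2 ^ lam i.+1))%g.
  by rewrite -!(autmE fA) -!morphX // e.
rewrite !FinRing.zmodXgE.
move/rowP/(_ i); rewrite !mulmxnE order_Zp_dvd => ->.
have /order_boxP/(_ i) : f z \in Ggroup n lam by apply: Aut_closed.
by rewrite order_Zp_dvd.
Qed.

(** * Diagonal and elementary automorphisms acting on a characteristic subgroup *)

Lemma char_scale n lam (H : {group amb n lam}) (u : 'I_n -> 'Z_(2 ^ (lmax n lam).+1)) g :
  (H \char Ggroup n lam)%g -> (forall j, u j \is a GRing.unit) -> g \in H ->
  (\row_j (u j * g ord0 j))%R \in H.
Proof.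
move=> chH hu; pose F (x : amb n lam) : amb n lam := (\row_j (u j * x ord0 j))%R.
apply: (char_endo_closed (F := F) chH) => [x y _ _|x y _ _ /rowP e|x /order_boxP hx].
- by apply/rowP=> j; rewrite !mxE mulrDr.
- by apply/rowP=> j; move: (e j); rewrite !mxE => /(mulrI (hu j)).
apply/order_boxP => j; rewrite mxE order_Zp_dvd -mulrnAr.
by move: (hx j); rewrite order_Zp_dvd => /eqP ->; rewrite mulr0.
Qed.

Definition axis_row n lam (i : 'I_n) z : amb n lam :=
  (\row_j if j == i then z else 0)%R.
Arguments axis_row {n} lam i z.

(** The vector is [F g - g] for the automorphism [F] adding [c] times coordinate [k] to coordinate
    [i]. The condition on [c] keeps [F] inside [G]; for [k = i], injectivity asks that [1 + c] be a
    unit. *)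
Lemma char_axis n lam (H : {group amb n lam}) (i k : 'I_n) c g :
  (H \char Ggroup n lam)%g ->
  (forall z : 'Z_(2 ^ (lmax n lam).+1),
     #[z]%g %| 2 ^ lam k.+1 -> #[(c * z)%R]%g %| 2 ^ lam i.+1) ->
  (k = i -> (1 + c)%R \is a GRing.unit) -> g \in H ->
  axis_row lam i (c * g ord0 k)%R \in H.
Proof.
move=> chH hc hu gH; pose F (x : amb n lam) := (x + axis_row lam i (c * x ord0 k))%R.
suff : F g \in H by rewrite /F -FinRing.zmodMgE groupMl.
move: g gH; apply: (char_endo_closed (F := F) chH) => [x y _ _|x y _ _ /rowP e|x xG].
- apply/rowP=> j; rewrite !mxE; case: eqP => _; last by rewrite !addr0.
  by rewrite mulrDr addrACA.
- have ek : x ord0 k = y ord0 k.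
    move: (e k); rewrite !mxE; case: eqP => [ki|_]; last by rewrite !addr0.
    by move=> e2; apply: (mulrI (hu ki)); rewrite !mulrDl !mul1r.
  apply/rowP=> j; move: (e j); rewrite !mxE ek.
  by case: eqP => _; [move/addIr | rewrite !addr0].
rewrite /F -FinRing.zmodMgE groupM //; apply/order_boxP=> j; rewrite mxE.
by case: eqP => [->|_]; [apply/hc; move/order_boxP: xG | rewrite order1].
Qed.

Lemma axis_row_generate n lam (H : {group amb n lam}) (i : 'I_n) y z :
  axis_row lam i y \in H -> #[z]%g %| #[y]%g -> axis_row lam i z \in H.
Proof.
move=> yH /order_Zp_mul [k ->].
suff -> : axis_row lam i (y *+ k)%R = (axis_row lam i y ^+ k)%g by apply: groupX.
rewrite FinRing.zmodXgE; apply/rowP=> j; rewrite mulmxnE !mxE.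
by case: eqP => // _; rewrite mul0rn.
Qed.

Lemma axis_row_sum n lam (H : {group amb n lam}) (g : amb n lam) :
  (forall i, axis_row lam i (g ord0 i) \in H) -> g \in H.
Proof.
move=> h; have -> : g = (\prod_(i < n) axis_row lam i (g ord0 i))%g.
  rewrite (_ : (\prod_(i < n) _)%g = (\sum_(i < n) axis_row lam i (g ord0 i))%R) //.
  apply/rowP=> j; rewrite summxE (bigD1 j) //= mxE eqxx big1 ?addr0 // => i ij.
  by rewrite mxE eq_sym (negPf ij).
exact: group_prod.
Qed.

(** * Types of elements and the vector [mvec] *)

Lemma mem_Tset n lam (a : tupT n lam) g : inLambda a ->
  (g \in Tset a) = [forall j, #[g ord0 j]%g == 2 ^ (a j : nat)].
Proof.
move/forallP=> ha; rewrite in_set andb_idl // => /forallP h.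
by apply/order_boxP=> j; rewrite (eqP (h j)) dvdn_exp2l.
Qed.

Lemma Tset_neq0 n lam (a : tupT n lam) : inLambda a -> exists g, g \in Tset a.
Proof.
move=> ha; have /fin_all_exists [x hx] : forall j : 'I_n,
    exists x : 'Z_(2 ^ (lmax n lam).+1), #[x]%g = 2 ^ (a j : nat).
  by move=> j; apply: exists_order_Zp; apply: ltnW; apply: ltn_ord.
exists (\row_j x j)%R; rewrite mem_Tset //; apply/forallP=> j.
by rewrite mxE hx.
Qed.

Lemma exists_Tset n lam (g : amb n lam) : g \in Ggroup n lam ->
  exists2 a : tupT n lam, inLambda a & g \in Tset a.
Proof.
move/order_boxP=> hg; have hl j : logn 2 #[g ord0 j]%g <= lam j.+1.
  by have := hg j; rewrite {1}order_Zp_pow2 dvdn_Pexp2l.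
pose a : tupT n lam := [ffun j => inord (logn 2 #[g ord0 j]%g)].
have ha j : a j = logn 2 #[g ord0 j]%g :> nat.
  by rewrite ffunE inordK // ltnS (leq_trans (hl j)) ?lam_le_lmax.
have aL : inLambda a by apply/forallP=> j; rewrite ha.
by exists a => //; rewrite mem_Tset //; apply/forallP=> j; rewrite ha -order_Zp_pow2.
Qed.

(** Two elements of the same type differ by a unit in each coordinate, that is, by a diagonal
    automorphism. *)
Lemma char_Tset_sub n lam (H : {group amb n lam}) (a : tupT n lam) g :
  (H \char Ggroup n lam)%g -> inLambda a -> g \in H -> g \in Tset a ->
  Tset a \subset H.
Proof.
move=> chH aL gH; rewrite mem_Tset // => /forallP hg.
apply/subsetP=> x; rewrite mem_Tset // => /forallP hx.
have /fin_all_exists [u hu] : forall j : 'I_n, exists u : 'Z_(2 ^ (lmax n lam).+1),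
    u \is a GRing.unit /\ x ord0 j = (u * g ord0 j)%R.
  move=> j; have [|u] := @order_Zp_unit _ (g ord0 j) (x ord0 j); last by exists u.
  by rewrite (eqP (hx j)) (eqP (hg j)).
suff -> : x = (\row_j (u j * g ord0 j))%R.
  by apply: char_scale => // j; case: (hu j).
by apply/rowP=> j; rewrite mxE; case: (hu j).
Qed.

Lemma char_order_dvd_mvec n lam (H : {group amb n lam}) j g :
  (H \char Ggroup n lam)%g -> g \in H -> #[g ord0 j]%g %| 2 ^ mvec H j.
Proof.
move=> chH gH; have gG := subsetP (char_sub chH) _ gH.
have [a aL ga] := exists_Tset gG.
have := ga; rewrite mem_Tset // => /forallP/(_ j)/eqP ->; apply: dvdn_exp2l.
rewrite /mvec (bigD1 a) /= ?leq_maxl // aL.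
exact: char_Tset_sub chH aL gH ga.
Qed.

Lemma order_eq_mvec n lam (H : {group amb n lam}) j :
  exists2 g, g \in H & #[g ord0 j]%g = 2 ^ mvec H j.
Proof.
pose P (a : tupT n lam) := inLambda a && (Tset a \subset H).
have [P0|Pn] := posnP #|P|.
  (* A maximum over an empty family is 0, the exponent attained by the identity. *)
  exists 1%g => //; rewrite mxE order1 /mvec big_pred0 // => a.
  exact: (card0_eq P0 a).
have [a /andP[aL aH]] := eq_bigmax_cond (fun a : tupT n lam => a j : nat) Pn.
rewrite /mvec => ->; have [g ga] := Tset_neq0 aL.
exists g; first exact: (subsetP aH).
by move: ga; rewrite mem_Tset // => /forallP/(_ j)/eqP.
Qed.

Lemma mvec_eq n lam (H : {group amb n lam}) j k g :
  (H \char Ggroup n lam)%g -> (forall x, x \in H -> #[x ord0 j]%g %| 2 ^ k) ->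
  g \in H -> #[g ord0 j]%g = 2 ^ k -> mvec H j = k.
Proof.
move=> chH hle gH hg; apply/eqP; rewrite eqn_leq.
have [x xH hx] := order_eq_mvec H j.
move: (hle x xH) (char_order_dvd_mvec j chH gH).
by rewrite hx hg !dvdn_Pexp2l // => -> ->.
Qed.

(** * Canonical tuples and their lowering *)

Lemma canonical_le n lam m i k : canonical n lam m -> 1 <= i <= k -> k <= n ->
  m i <= m k /\ m k + lam i <= lam k + m i.
Proof.
case=> _ hmon hlip /andP[i1]; elim: k => [|k IHk]; first by lia.
rewrite leq_eqVlt => /orP[/eqP -> |ik] kn; first by lia.
have [] := IHk ik (ltnW kn); have := hmon k.+1; have := hlip k; rewrite /=; lia.
Qed.

Lemma canonical_box_char n lam m : canonical n lam m ->
  (order_box_group n lam m \char Ggroup n lam)%g.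
Proof.
move=> hcan; apply: order_box_char => [i|i k ik|i k ik].
- by case: hcan => h _ _; apply: h; rewrite ltn_ord.
- by have [] := canonical_le (i := i.+1) (k := k.+1) hcan ik (ltn_ord k).
- by have [] := canonical_le (i := i.+1) (k := k.+1) hcan ik (ltn_ord k).
Qed.

Lemma nondegenerate_gt0 n lam m i : canonical n lam m -> 1 <= i <= n ->
  ~~ degenerate n lam m i -> 0 < m i.
Proof.
case=> _ hmon _ hi; rewrite /degenerate /ext0 negb_or => /andP[h _].
have := hmon i; move: h; case: (m i) => //.
by case: i hi => [|[|i]] //= hi h /(_ hi); case: (m i.+1) h.
Qed.

Definition decr (m : nat -> nat) i k := if k == i then (m k).-1 else m k.

(** Lowering [m_i] tightens only [m_(i-1) <= m_i] and the bound on [m_(i+1) - m_i]. Nondegeneracy at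
    [i] says that both are strict, so they survive a drop by one. *)
Lemma canonical_decr n lam m i : canonical n lam m -> 1 <= i <= n ->
  ~~ degenerate n lam m i -> canonical n lam (decr m i).
Proof.
move=> hcan hi hd; have := nondegenerate_gt0 hcan hi hd.
case: hcan => hle hmon hlip m0; split=> k hk; rewrite /decr.
- by case: eqP; have := hle k hk; lia.
- have := hmon k hk; case: (k =P i) => [ki|_]; last by case: eqP; lia.
  by move: hd; rewrite /degenerate /ext0 ki; do !case: eqP; lia.
- have := hlip k hk; case: (k =P i) => [ki|_].
    by move: hd; rewrite /degenerate ki; do !case: eqP; lia.
  case: eqP => [ki|]; last by lia.
  by rewrite ki; lia.
Qed.

(** * The smaller box inside every characteristic subgroup below [m] *)

Lemma char_Aut_mem (gT : finGroupType) (G A : {group gT}) f x :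
  (A \char G)%g -> f \in Aut G -> (f x \in A) = (x \in A).
Proof.
move=> /andP[_ /forall_inP h]; have cl g y : g \in Aut G -> y \in A -> g y \in A.
  by move=> gG yA; apply: (subsetP (h g gG)); apply: imset_f.
move=> fG; apply/idP/idP=> [/(cl f^-1%g)|]; last exact: cl.
by rewrite permK; apply; rewrite groupV.
Qed.

(* Used with [k = i], [d = 1] at a nondegenerate coordinate, and with
   [k = i - 1], [d = 0] or [k = i + 1], [d = lam_(i+1) - lam_i] at a degenerate
   one. *)
Lemma char_below_axis n lam m (H : {group amb n lam}) (i k : 'I_n) d z :
  char_below m H -> lam k.+1 <= lam i.+1 + d -> (k = i -> d = 1) ->
  d <= m k.+1 -> #[z]%g %| 2 ^ (m k.+1 - d) -> axis_row lam i z \in H.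
Proof.
move=> [chH hm] hlam hki hd hz; have [h hH oh] := order_eq_mvec H k.
rewrite hm in oh.
(* With [h_k] of order [2 ^ m_k], the multiple [2 ^ d * h_k] has order [2 ^ (m_k - d)], so it
   generates every admissible [z]. *)
apply: (@axis_row_generate _ _ _ _ ((2 ^ d)%:R * h ord0 k)%R); last first.
  rewrite mulr_natl -FinRing.zmodXgE orderXdiv oh ?dvdn_exp2l //.
  by rewrite -expnB.
apply: char_axis => // [x|/hki ->].
  rewrite mulr_natl !order_Zp_dvd -mulrnA -expnD => /eqP hx.
  by rewrite addnC -(subnK hlam) addnC expnD mulrnA hx mul0rn.
(* Here [d = 1], and [1 + 2 ^ d = 3] is odd. *)
rewrite -(natrD _ 1 2) unitZpE ?exp2S_gt1 //.
by rewrite coprime_pexpl.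
Qed.

Definition core n lam (m : nat -> nat) i :=
  if degenerate n lam m i then m i else (m i).-1.

Lemma core_sub_char_below n lam m (H : {group amb n lam}) :
  (forall i, 1 <= i < n -> lam i <= lam i.+1) -> canonical n lam m ->
  char_below m H -> order_box lam (core n lam m) \subset H.
Proof.
move=> hsort hcan hH; apply/subsetP=> g /order_boxP hg.
apply: axis_row_sum => i; move: (g ord0 i) (hg i) => z; rewrite /core.
have [m0|m0] := posnP (m i.+1).
  rewrite m0 if_same dvdn1 order_eq1 => /eqP ->.
  suff -> : axis_row lam i 1%g = 1%g by apply: group1.
  by apply/rowP=> j; rewrite !mxE; case: eqP.
case: ifPn => hd; last first.
  rewrite -subn1; apply: char_below_axis => //; lia.
case/orP: hd => [/eqP e|/andP[i1 /eqP e]].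
  (* At the first coordinate this degeneracy would read [m_1 = 0], against positivity, so a
     preceding coordinate exists. *)
  rewrite /ext0 /= in e; case: i m0 e => [[|i] ilt] /= m0 e.
    by rewrite e in m0.
  have ilt' := ltnW ilt; rewrite e -[m _]subn0.
  apply: (@char_below_axis _ _ _ _ _ (Ordinal ilt')) => //=.
    by rewrite addn0; apply: hsort.
  by move/(congr1 val) => /=; lia.
have hl := hsort i.+1 i1.
have -> : m i.+1 = m i.+2 - (lam i.+2 - lam i.+1) by lia.
apply: (@char_below_axis _ _ _ _ _ (Ordinal i1)) => //=; try lia.
by move/(congr1 val) => /=; lia.
Qed.

(** * The projection onto [Z_2^r] *)

(* [c] selects coordinates; when these are the nondegenerate ones, this is the
   projection of the box of [m] onto its quotient by the box of [core m]. *)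
Definition bit_row n lam r (m : nat -> nat) (c : 'I_r -> 'I_n) (g : amb n lam) :
    'rV['Z_2]_r :=
  (\row_j if (#[g ord0 (c j)]%g %| 2 ^ (m (c j).+1).-1)%N then 0 else 1)%R.

Lemma bit_rowM n lam r m (c : 'I_r -> 'I_n) :
  {in order_box lam m &, {morph bit_row (lam := lam) m c : x y / (x * y)%g}}.
Proof.
move=> x y /order_boxP hx /order_boxP hy; apply/rowP=> j.
by rewrite !mxE order_Zp_dvdD //; do 2 case: (_ %| _) => //=; apply: val_inj.
Qed.
Canonical bit_morphism n lam r m (c : 'I_r -> 'I_n) := Morphism (@bit_rowM n lam r m c).

Lemma Z2_cases (x : 'Z_2) : x = 0%R \/ x = 1%R.
Proof. by case: x => [[|[|k]] //= lt]; [left | right]; apply: val_inj. Qed.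

Lemma bit_row_ker n lam r m (c : 'I_r -> 'I_n) :
  (forall i : 'I_n, ~~ degenerate n lam m i.+1 -> exists j, c j = i) ->
  ('ker (bit_morphism lam m c))%g \subset order_box lam (core n lam m).
Proof.
move=> hc; apply/subsetP=> g /morphpreP[/order_boxP hg /set1P /rowP e].
apply/order_boxP=> i; rewrite /core; case: ifPn => // /hc [j <-].
by move: (e j); rewrite !mxE; case: ifP.
Qed.

(** Inside the box of [m], bit [j] vanishes exactly on the box of [decr m (c j).+1], which is again
    characteristic. *)
Lemma bit_row_Aut n lam r m (c : 'I_r -> 'I_n) f g :
  canonical n lam m -> (forall j, ~~ degenerate n lam m (c j).+1) ->
  f \in Aut (Ggroup n lam) -> g \in order_box lam m ->
  bit_row m c (f g) = bit_row m c g.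
Proof.
move=> hcan hc fG gm; apply/rowP=> j; rewrite !mxE; congr (if _ then _ else _).
have chm := canonical_box_char hcan.
have hcj : 1 <= (c j).+1 <= n by rewrite ltn_ord.
have chd := canonical_box_char (canonical_decr hcan hcj (hc j)).
have bitE x : x \in order_box lam m ->
    (#[x ord0 (c j)]%g %| 2 ^ (m (c j).+1).-1) = (x \in order_box lam (decr m (c j).+1)).
  move=> /order_boxP hx; apply/idP/order_boxP => [h i|/(_ (c j))]; last first.
    by rewrite /decr eqxx.
  by rewrite /decr; case: eqP => [[/val_inj ->]|].
rewrite !bitE //; last by rewrite (char_Aut_mem g chm fG).
exact: (char_Aut_mem g chd fG).
Qed.

Lemma bit_row_surj n lam r m (c : 'I_r -> 'I_n) :
  canonical n lam m -> (forall j, ~~ degenerate n lam m (c j).+1) -> injective c ->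
  (bit_morphism lam m c @* order_box lam m)%g = [set: 'rV['Z_2]_r].
Proof.
move=> hcan hc ic; apply/eqP; rewrite eqEsubset subsetT; apply/subsetP=> k _.
have /fin_all_exists [q hq] : forall i : 'I_n,
    exists x : 'Z_(2 ^ (lmax n lam).+1), #[x]%g = 2 ^ m i.+1.
  move=> i; apply: exists_order_Zp; apply: leqW; apply: leq_trans (lam_le_lmax lam i).
  by case: hcan => h _ _; apply: h; rewrite ltn_ord.
(* The preimage has the full order [2 ^ m_i] where the prescribed bit is nonzero and vanishes
   elsewhere; injectivity of [c] keeps the prescriptions compatible. *)
pose g : amb n lam :=
  (\row_i if [exists j, (c j == i) && (k ord0 j != 0)] then q i else 0)%R.
have gm : g \in order_box lam m.
  by apply/order_boxP=> i; rewrite mxE; case: ifP; rewrite ?hq // order1.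
apply/morphimP; exists g => //; apply/rowP=> j; rewrite !mxE.
case: existsP => [[j' /andP[/eqP /ic -> kj]]|h].
  have m0 : 0 < m (c j).+1 by apply: nondegenerate_gt0 hcan _ (hc j); rewrite ltn_ord.
  rewrite hq dvdn_Pexp2l // ifN; last by rewrite -ltnNge ltn_predL.
  by case: (Z2_cases (k ord0 j)) kj => -> //; rewrite eqxx.
rewrite order1 dvd1n; apply/eqP; apply: contra_notT h => kj.
by exists j; rewrite eqxx.
Qed.

(** * The correspondence of subgroups *)

Lemma nondegenerate_enum n lam m :
  exists c : 'I_(nondeg_count n lam m) -> 'I_n,
  [/\ injective c, forall j, ~~ degenerate n lam m (c j).+1 &
      forall i : 'I_n, ~~ degenerate n lam m i.+1 -> exists j, c j = i].
Proof.
pose P := [pred i : 'I_n | ~~ degenerate n lam m i.+1].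
have e : nondeg_count n lam m = #|P|.
  rewrite /nondeg_count -[1]/(1 + 0) iotaDl -val_enum_ord -map_comp count_map.
  by rewrite cardE size_filter enumT; apply: eq_count => i.
exists (fun j => enum_val (cast_ord e j)); split.
- by move=> i j /enum_val_inj /cast_ord_inj.
- by move=> j; have := enum_valP (cast_ord e j).
move=> i hi; have hiP : i \in P by [].
exists (cast_ord (esym e) (enum_rank_in hiP i)).
by rewrite cast_ordKV enum_rankK_in.
Qed.

Lemma bit_preim_char_below n lam m r (c : 'I_r -> 'I_n) (K : {group 'rV['Z_2]_r}) :
  canonical n lam m -> (forall j, ~~ degenerate n lam m (c j).+1) -> injective c ->
  (forall i : 'I_n, ~~ degenerate n lam m i.+1 -> exists j, c j = i) ->
  proj_surj K -> char_below m (bit_morphism lam m c @*^-1 K)%G.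
Proof.
move=> hcan hc ic sc hK; have chm := canonical_box_char hcan.
have chH : ((bit_morphism lam m c @*^-1 K)%G \char Ggroup n lam)%g.
  rewrite /characteristic (subset_trans _ (char_sub chm)) ?subsetIl //=.
  apply/forall_inP=> f fG; apply/subsetP=> _ /imsetP[x /morphpreP[xm xK] ->].
  apply/morphpreP; split; first by rewrite (char_Aut_mem x chm fG).
  by rewrite /= bit_row_Aut.
split=> // i.
suff [g gH og] : exists2 g, g \in (bit_morphism lam m c @*^-1 K)%g &
    #[g ord0 i]%g = 2 ^ m i.+1.
  by apply: (mvec_eq chH _ gH og) => x /morphpreP[/order_boxP].
have [hd|hd] := boolP (degenerate n lam m i.+1).
  have [|q hq] := @exists_order_Zp (lmax n lam) (m i.+1).
    apply: leqW; apply: leq_trans (lam_le_lmax lam i).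
    by case: hcan => h _ _; apply: h; rewrite ltn_ord.
  (* At a degenerate coordinate, no [c j] equals [i], so this element has all bits zero and lies in
     every preimage. *)
  exists (axis_row lam i q); last by rewrite mxE eqxx.
  apply/morphpreP; split.
    by apply/order_boxP=> j; rewrite mxE; case: eqP => [->|_]; rewrite ?hq ?order1.
  rewrite /= (_ : bit_row _ _ _ = 1%g) ?group1 //; apply/rowP=> j; rewrite !mxE.
  case: eqP => [e|_]; last by rewrite order1 dvd1n.
  by move: (hc j); rewrite e hd.
have [j ej] := sc i hd.
have : (1%R : 'Z_2) \in [set (k : 'rV['Z_2]_r) ord0 j | k in K] by rewrite hK inE.
case/imsetP=> k kK k1; have : k \in (bit_morphism lam m c @* order_box lam m)%g.
  by rewrite bit_row_surj.
case/morphimP=> g gm _ /= ek; exists g; first by apply/morphpreP; rewrite /= -ek.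
have /order_boxP/(_ i) := gm; rewrite order_Zp_pow2 dvdn_Pexp2l // => le.
(* An exponent below [m_i] would make bit [j] of [g] zero, whereas [k] was chosen with that bit
   equal to 1. *)
congr (2 ^ _); apply/eqP; rewrite eqn_leq le leqNgt; apply/negP=> lt.
move: k1; rewrite ek mxE ej order_Zp_pow2 dvdn_Pexp2l //.
by rewrite (_ : _ <= _) //; lia.
Qed.

(** The identity gives bit 0, and an element attaining [mvec H (c j)] gives bit 1. *)
Lemma bit_image_proj_surj n lam m r (c : 'I_r -> 'I_n) (H : {group amb n lam}) :
  canonical n lam m -> (forall j, ~~ degenerate n lam m (c j).+1) ->
  H \subset order_box lam m -> char_below m H ->
  proj_surj (bit_morphism lam m c @* H)%G.
Proof.
move=> hcan hc sH [chH hm] j; apply/eqP; rewrite eqEsubset subsetT.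
apply/subsetP=> b _; apply/imsetP.
case: (Z2_cases b) => ->; first by exists 1%g; rewrite ?group1 // mxE.
have [g gH og] := order_eq_mvec H (c j).
exists (bit_row m c g); first by apply: (mem_morphim (bit_morphism lam m c)) => //; apply: (subsetP sH).
have m0 : 0 < m (c j).+1 by apply: nondegenerate_gt0 hcan _ (hc j); rewrite ltn_ord.
by rewrite mxE og hm dvdn_Pexp2l // ifN // -ltnNge ltn_predL.
Qed.

Theorem mainTheorem4 (n : nat) (lam m : nat -> nat)
  (hsorted : forall i, 1 <= i < n -> lam i <= lam i.+1)
  (hcan : canonical n lam m) :
  exists f : {H : {group amb n lam} | char_below m H} ->
             {K : {group 'rV['Z_2]_(nondeg_count n lam m)} | proj_surj K},
    bijective f.
Proof.
have [c [ic hc sc]] := nondegenerate_enum n lam m.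
have sH (H : {group amb n lam}) : char_below m H -> H \subset order_box lam m.
  case=> chH hm; apply/subsetP=> g gH; apply/order_boxP=> j; rewrite -hm.
  exact: char_order_dvd_mvec.
pose f (H : {H : {group amb n lam} | char_below m H}) :=
  exist (@proj_surj _) _
    (bit_image_proj_surj hcan hc (sH _ (proj2_sig H)) (proj2_sig H)).
pose h (K : {K : {group 'rV['Z_2]_(nondeg_count n lam m)} | proj_surj K}) :=
  exist (char_below m) _ (bit_preim_char_below hcan hc ic sc (proj2_sig K)).
(* Proof irrelevance leaves equalities of subgroups: the first holds because the kernel lies in the
   smaller box, hence in [H]; the second because the projection is onto. *)
exists f; exists h => [[H hH]|[K hK]]; apply: subset_eq_compat; apply: group_inj => /=.
  apply: morphimGK; last exact: (sH H hH).
  exact: subset_trans (bit_row_ker sc) (core_sub_char_below hsorted hcan hH).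
by apply: morphpreK; rewrite bit_row_surj ?subsetT.
Qed.
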